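(* Let $K$ be a field and let $I$ be a monomial ideal in $S=K[x_1,\ldots,x_n]$ with $\dim S/I=0$. Let $\Delta(I)$ be the simplicial complex whose Stanley--Reisner ideal is the polarization $I^\wp$ of $I$. Then $\Delta(I)$ is vertex decomposable.
   Context: For a monomial ideal $I$, $G(I)$ is its unique minimal set of monomial generators. For $i=1,\ldots,n$ let $b_i\ge 1$ be the smallest integer with $x_i^{b_i}\in I$ (it exists since $\dim S/I=0$). $S^\wp$ is the polynomial ring over $K$ in the variables $x_{i,j}$, $1\le i\le n$, $1\le j\le b_i$. The polarization of a monomial $v=x_1^{c_1}\cdots x_n^{c_n}$ with $c_i\le b_i$ is $v^\wp=\prod_{i=1}^n\prod_{j=1}^{c_i}x_{i,j}$, and the polarization of $I$ is the ideal $I^\wp\subset S^\wp$ generated by the monomials $v^\wp$ with $v\in G(I)$. $\Delta(I)$ is the simplicial complex on the set $\mathcal{S}$ of variables of $S^\wp$ whose faces are the subsets $F\subset\mathcal{S}$ with $\prod_{x\in F}x\notin I^\wp$ (a variable need not itself be a face). A simplicial complex $\Delta$ is (recursively) called vertex decomposable if $\Delta$ is a simplex (including $\{\emptyset\}$), or $\Delta$ contains a vertex $v$ such that (i) any facet of $\operatorname{del}_\Delta(v)$ is a facet of $\Delta$, and (ii) both $\operatorname{del}_\Delta(v)$ and $\operatorname{link}_\Delta(v)$ are vertex decomposable. Here $\operatorname{link}_\Delta(v)=\{G\in\Delta : v\notin G \text{ and } G\cup\{v\}\in\Delta\}$ and $\operatorname{del}_\Delta(v)=\{G\in\Delta : v\notin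 G\}$. *)

(* Defs.v *)
From HB Require Import structures.
From Stdlib Require ClassicalEpsilon.
From mathcomp Require Import all_boot all_order all_algebra.
From mathcomp Require Import ring_quotient boolp.
From mathcomp Require Import mpoly.

Set Implicit Arguments.
Unset Strict Implicit.
Unset Printing Implicit Defensive.

Import GRing.Theory.
Local Open Scope ring_scope.

Definition prime_chain (A : comNzRingType) (d : nat)
    (P : 'I_d.+1 -> prime_idealr A) : Prop :=
  forall k l : 'I_d.+1, (k < l)%N ->
    {subset P k <= P l} /\ ~ {subset P l <= P k}.

(* [A] has Krull dimension exactly [d]: the supremum of the lengths of chains
   of prime ideals is attained and equal to [d]. Every nonempty chain of
   length [e > d] truncates to one of length [d.+1]. *)
Definition krull_dim (A : comNzRingType) (d : nat) : Prop :=
  (exists P : 'I_d.+1 -> prime_idealr A, prime_chain P) /\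
  ~ (exists P : 'I_d.+2 -> prime_idealr A, prime_chain P).

Definition gen_ideal (R : comNzRingType) (G : R -> Prop) : {pred R} :=
  fun x => `[< exists s : seq (R * R),
    (forall ag, ag \in s -> G ag.2) /\ x = \sum_(ag <- s) ag.1 * ag.2 >].

Lemma gen_idealMr (R : comNzRingType) (G : R -> Prop) (a u : R) :
  u \in gen_ideal G -> a * u \in gen_ideal G.
Proof.
move=> /asboolP[s [sG ->]]; apply/asboolP.
exists [seq (a * ag.1, ag.2) | ag <- s]; split.
  by move=> _ /mapP[ag ag_s ->] /=; apply: sG.
by rewrite big_map mulr_sumr; apply: eq_bigr => ag _ /=; rewrite mulrA.
Qed.

Section MonomialIdeals.
Variables (K : fieldType) (n : nat).
Implicit Types (I : {pred {mpoly K[n]}}) (M : {pred 'X_{1..n}}).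

Definition generated_by_monomials I M : Prop :=
  I =i gen_ideal (fun p => exists2 m, m \in M & p = 'X_[m]).

Definition monomial_ideal I : Prop := exists M, generated_by_monomials I M.

Definition minimal_monomial_generators I M : Prop :=
  generated_by_monomials I M /\
  forall M', {subset M' <= M} -> generated_by_monomials I M' ->
    {subset M <= M'}.

(* The set G(I); a monomial ideal has exactly one minimal set of monomial
   generators, so the choice is immaterial. *)
Definition min_gens I : {pred 'X_{1..n}} :=
  ClassicalEpsilon.epsilon (inhabits (pred0 : {pred 'X_{1..n}}))
    (minimal_monomial_generators I).

(* The least [b] with [x_i ^ b] in [I]; unspecified if there is none. *)
Definition var_exp I (i : 'I_n) : nat :=
  ClassicalEpsilon.epsilon (inhabits 0%N)
    (fun b => 'X_i ^+ b \in I /\ forall k, 'X_i ^+ k \in I -> (b <= k)%N).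

(* The variable [x_{i,j}], for [1 <= j <= b_i], is the pair of [i] and the
   ordinal [j - 1]. *)
Definition polvar I : finType := {i : 'I_n & 'I_(var_exp I i)}.

(* [{mpoly K[_]}] numbers its variables, hence the use of [enum_rank]. *)
Definition polring I := {mpoly K[#|polvar I|]}.

Definition polX I (x : polvar I) : polring I := 'X_(enum_rank x).

Definition polarize I (v : 'X_{1..n}) : polring I :=
  \prod_(i < n) \prod_(j < var_exp I i | (j < v i)%N)
    polX (Tagged (fun i => 'I_(var_exp I i)) j).

Definition polarization I : {pred polring I} :=
  gen_ideal (fun p => exists2 v, v \in min_gens I & p = polarize I v).

End MonomialIdeals.

Arguments polarization {K n} I.

Section SimplicialComplexes.
Variable V : finType.

(* The elements of [V] need not be vertices. *)
Record simplicial_complex := SimplicialComplex {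
  faces :> {set {set V}};
  faces_closed : forall F G : {set V},
    F \in faces -> G \subset F -> G \in faces
}.

Implicit Types (D : simplicial_complex) (v : V).

Definition facet D (F : {set V}) : bool := maxset (fun G => G \in faces D) F.

Definition simplex D : Prop := exists A : {set V}, faces D = powerset A.

Definition del_faces D v : {set {set V}} := [set G in faces D | v \notin G].

Definition link_faces D v : {set {set V}} :=
  [set G in faces D | (v \notin G) && (v |: G \in faces D)].

Lemma del_closed D v (F G : {set V}) :
  F \in del_faces D v -> G \subset F -> G \in del_faces D v.
Proof.
rewrite !inE => /andP[DF vF] GF; rewrite (faces_closed DF GF) /=.
by apply: contra vF; apply: (subsetP GF).
Qed.

Lemma link_closed D v (F G : {set V}) :
  F \in link_faces D v -> G \subset F -> G \in link_faces D v.
Proof.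
rewrite !inE => /and3P[DF vF DvF] GF; rewrite (faces_closed DF GF) /=.
rewrite (faces_closed DvF (setUS _ GF)) andbT.
by apply: contra vF; apply: (subsetP GF).
Qed.

Definition del D v : simplicial_complex :=
  SimplicialComplex (@del_closed D v).

Definition link D v : simplicial_complex :=
  SimplicialComplex (@link_closed D v).

Inductive vertex_decomposable : simplicial_complex -> Prop :=
| VD_simplex D : simplex D -> vertex_decomposable D
| VD_shedding D v :
    [set v] \in faces D ->
    (forall F, facet (del D v) F -> facet D F) ->
    vertex_decomposable (del D v) ->
    vertex_decomposable (link D v) ->
    vertex_decomposable D.

End SimplicialComplexes.

Section PolarizationComplex.
Variables (K : fieldType) (n : nat) (I : {pred {mpoly K[n]}}).

Definition Delta_faces : {set {set polvar I}} :=
  [set F : {set polvar I} | \prod_(x in F) polX x \notin polarization I].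

Lemma Delta_closed (F G : {set polvar I}) :
  F \in Delta_faces -> G \subset F -> G \in Delta_faces.
Proof.
rewrite !inE => FI GF; apply: contra FI => GI.
rewrite (big_setID G) /= (setIidPr GF) mulrC.
exact: gen_idealMr.
Qed.

Definition Delta : simplicial_complex (polvar I) :=
  SimplicialComplex Delta_closed.

End PolarizationComplex.

(* Main.v *)
(* For each i, the variables x_{i,1}, ..., x_{i,b_i} form a column. A set of
   variables is a face of Delta(I) unless it contains the initial segments
   {x_{i,j} : j <= v_i} of all columns, for some v in G(I). Hence
     - no face contains a whole column, because x_i^{b_i} is in I;
     - if x precedes y in a column and a face omits x, then y can be added to
       this face.
   These two properties, together with the requirement that every vertex outside
   the columns is a cone point, survive when the first element x of a column is
   shed: deleting x turns the rest of its column into cone points, and passing to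
   the link of x only shortens the column. A facet of the deletion contains the
   rest of the column by the second property, so by the first one it is still a
   facet once x is allowed. When all columns are exhausted, only cone points
   are left and the complex is a simplex. *)

Require Import Defs.
From HB Require Import structures.
From mathcomp Require Import all_boot all_order all_algebra.
From mathcomp Require Import ring_quotient generic_quotient boolp mpoly.

Set Implicit Arguments.
Unset Strict Implicit.
Unset Printing Implicit Defensive.

Import GRing.Theory.
Local Open Scope ring_scope.

(** * Shedding a complex column by column *)

Section Columns.
Variable V : finType.
Implicit Types (D : simplicial_complex V) (ss : seq (seq V)).

(** [subseq [:: x; y] s] encodes that [x] precedes [y] in the column [s]. Elements of a column need
    not be vertices. *)
Record shedding_columns D ss : Prop := SheddingColumns {
  columns_uniq : uniq (flatten ss);
  columns_notin : forall s (F : {set V}), s \in ss -> F \in faces D ->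
    ~~ all (mem F) s;
  columns_add : forall s x y (F : {set V}), s \in ss -> subseq [:: x; y] s ->
    F \in faces D -> x \notin F -> y |: F \in faces D;
  columns_cone : forall y (F : {set V}), y \notin flatten ss ->
    [set y] \in faces D -> F \in faces D -> y |: F \in faces D
}.

Lemma simplex_of_cone D :
  set0 \in faces D ->
  (forall y F, [set y] \in faces D -> F \in faces D -> y |: F \in faces D) ->
  simplex D.
Proof.
move=> D0 cone; exists [set y | [set y] \in faces D].
apply/setP => F; rewrite powersetE; apply/idP/subsetP => [DF y yF | subF].
  by rewrite inE (faces_closed DF) ?sub1set.
rewrite -[F]set_enum; have: {subset enum F <= F} by move=> y; rewrite mem_enum.
elim: (enum F) => [|y s IHs] sF; first by rewrite set_nil.
rewrite set_cons cone //.
  by have := subF y (sF _ (mem_head _ _)); rewrite inE.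
by apply: IHs => z zs; apply: sF; rewrite inE zs orbT.
Qed.

(** [D'] is kept abstract to cover both the deletion of [x] and [D] itself when [x] is not a
    vertex. *)
Lemma shedding_columns_drop D D' x t ss :
  shedding_columns D ((x :: t) :: ss) ->
  (forall F : {set V}, (F \in faces D') = (F \in faces D) && (x \notin F)) ->
  shedding_columns D' ss.
Proof.
case=> /= /andP[]; rewrite mem_cat => /norP[xt xss]; rewrite cat_uniq.
case/and3P=> ut /hasPn tss uss Dn Da Dc D'E.
split=> // [s F sss|s y z F sss yzs|y F yss]; rewrite !D'E.
- by case/andP=> DF _; apply: Dn => //; rewrite inE sss orbT.
- case/andP=> DF xF yF; rewrite (Da s y) ?inE ?sss ?orbT //= negb_or xF andbT.
  apply: contra xss => /eqP->; apply/flattenP; exists s => //.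
  by apply: (mem_subseq yzs); rewrite !inE eqxx orbT.
rewrite inE => /andP[Dy xy] /andP[DF xF].
rewrite !inE negb_or xy xF !andbT.
have [yt|yt] := boolP (y \in t).
  by apply: (Da (x :: t) x) => //=; rewrite ?mem_head // eqxx sub1seq.
by apply: Dc => //; rewrite inE mem_cat !negb_or eq_sym xy yt.
Qed.

Lemma shedding_columns_link D x t ss :
  shedding_columns D ((x :: t) :: ss) ->
  shedding_columns (link D x) (t :: ss).
Proof.
case=> /= /andP[xtss utss] Dn Da Dc.
have ssP s : s \in t :: ss -> exists2 s', s' \in (x :: t) :: ss & subseq s s'.
  rewrite inE => /predU1P[->|sss]; last by exists s; rewrite ?inE ?sss ?orbT.
  by exists (x :: t); [exact: mem_head | exact: subseq_cons].
have xNs s : s \in t :: ss -> x \notin s.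
  move=> sss; apply: contra xtss => xs.
  by apply/(@flattenP _ (t :: ss)); exists s.
split=> // [s F|s y z F sss yzs|y F ytss]; rewrite !inE => //.
- case/predU1P=> [->|sss] /and3P[DF _ DxF]; last first.
    by apply: Dn => //; rewrite inE sss orbT.
  (* The face [x |: F] omits some element of [x :: t], which must lie in [t]. *)
  have := Dn (x :: t) _ (mem_head _ _) DxF; rewrite /= setU11 /=.
  apply: contra => /allP tF; apply/allP => y /tF.
  exact: (subsetP (subsetUr _ _)).
- case/and3P=> DF xF DxF yF; have [s' s'ss ss'] := ssP s sss.
  have yzs' := subseq_trans yzs ss'.
  have neq w : w \in s -> w != x.
    by move=> ws; apply: contraNneq (xNs s sss) => <-.
  have zx : z != x by apply/neq/(mem_subseq yzs); rewrite !inE eqxx orbT.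
  have yx : y != x by apply/neq/(mem_subseq yzs); rewrite !inE eqxx.
  rewrite (Da s' y) //= negb_or eq_sym zx xF /= setUCA (Da s' y) //.
  by rewrite !inE negb_or yx.
case/and3P=> Dy xy Dxy /and3P[DF xF DxF].
have yss : y \notin x :: flatten (t :: ss) by rewrite inE negb_or eq_sym xy.
by rewrite Dc //= negb_or xy xF /= setUCA Dc.
Qed.

Lemma facet_del_column_head D x t ss (F : {set V}) :
  shedding_columns D ((x :: t) :: ss) -> facet (del D x) F -> facet D F.
Proof.
case=> /= /andP[xtss _] Dn Da _ /maxsetP[]; rewrite !inE => /andP[DF xF] maxF.
apply/maxsetP; split=> // G DG FG.
have [xG|xG] := boolP (x \in G); last by apply: maxF => //; rewrite inE DG.
have /negP[] := Dn _ G (mem_head _ _) DG; rewrite /= xG /=; apply/allP => y yt.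
apply: (subsetP FG); rewrite -(maxF (y |: F)) ?setU11 ?subsetUr //.
rewrite !inE negb_or xF andbT (Da (x :: t) x) ?mem_head //=.
  by apply: contraNneq xtss => ->; rewrite mem_cat yt.
by rewrite eqxx sub1seq.
Qed.

Lemma shedding_columns_vertex_decomposable D ss :
  set0 \in faces D -> shedding_columns D ss -> vertex_decomposable D.
Proof.
elim: ss D => [|s ss IHss] D D0 DC.
  by apply/VD_simplex/simplex_of_cone => // y F; apply: (columns_cone DC).
elim: s D D0 DC => [|x t IHt] D D0 DC.
  by have := columns_notin DC (mem_head _ _) D0.
have [Dx|Dx] := boolP ([set x] \in faces D).
  apply: (VD_shedding Dx).
  - by move=> F; apply: facet_del_column_head DC.
  - apply: IHss; first by rewrite !inE D0.
    by apply: (shedding_columns_drop DC) => F; rewrite inE.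
  - apply: IHt; last exact: shedding_columns_link DC.
    by rewrite !inE setU0 D0 Dx.
(* Here [x] lies in no face, so [D] is its own deletion and the column is dropped without
   shedding. *)
apply: IHss => //; apply: (shedding_columns_drop DC) => F.
have [DF|//] := boolP (F \in faces D); apply/esym/negP => xF.
by case/negP: Dx; rewrite (faces_closed DF) ?sub1set.
Qed.

End Columns.

(** * Ideals generated by a set *)

Section GeneratedIdeals.
Variables (R : comNzRingType) (G : R -> Prop).

Lemma mem_gen_ideal g : G g -> g \in gen_ideal G.
Proof.
move=> Gg; apply/asboolP; exists [:: (1, g)]; rewrite big_seq1 mul1r.
by split=> // ag; rewrite inE => /eqP->.
Qed.

Lemma gen_ideal_morph_eq0 (S : nzRingType) (phi : {rmorphism R -> S}) u :
  (forall g, G g -> phi g = 0) -> u \in gen_ideal G -> phi u = 0.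
Proof.
move=> phi0 /asboolP[s [sG ->]]; rewrite rmorph_sum big_seq.
by apply: big1 => ag /sG Gag; rewrite rmorphM (phi0 _ Gag) mulr0.
Qed.

End GeneratedIdeals.

Lemma gen_ideal_sub (R : comNzRingType) (G H : R -> Prop) u :
  (forall g, G g -> g \in gen_ideal H) ->
  u \in gen_ideal G -> u \in gen_ideal H.
Proof.
move=> GH /asboolP[s [sG ->]].
elim: s sG => [_|ag s IHs sG].
  by apply/asboolP; exists [::]; rewrite !big_nil.
have /asboolP[s1 [s1H E1]] := gen_idealMr ag.1 (GH _ (sG _ (mem_head _ _))).
have /asboolP[s2 [s2H E2]] :
    \sum_(j <- s) j.1 * j.2 \in gen_ideal H.
  by apply: IHs => bg bgs; apply: sG; rewrite inE bgs orbT.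
apply/asboolP; exists (s1 ++ s2); rewrite big_cons big_cat /= -E1 -E2.
by split=> // bg; rewrite mem_cat => /orP[/s1H|/s2H].
Qed.

(** * Monomial ideals and their minimal generators *)

Section MonomialIdeals.
Variables (K : fieldType) (n : nat).
Implicit Types (I : {pred {mpoly K[n]}}) (M : {pred 'X_{1..n}}).

(** Some term [p * 'X_[v]] has a nonzero coefficient at [m], and every monomial of such a product is
    a multiple of [v]. *)
Lemma mem_monomial_ideal I M m : generated_by_monomials I M ->
  'X_[m] \in I -> exists2 v, v \in M & (v <= m)%MM.
Proof.
move=> IM; rewrite IM => /asboolP[s [sM Em]].
have: ('X_[m] : {mpoly K[n]})@_m != 0 by rewrite mcoeffX eqxx oner_eq0.
rewrite {}Em raddf_sum; apply: contra_neqP => Nm; rewrite big_seq.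
apply: big1 => ag /sM[v vM ->].
rewrite [ag.1]mpolyE mulr_suml raddf_sum /=; apply: big1 => k _.
rewrite -scalerAl -mpolyXD mcoeffZ mcoeffX.
have [Ek|_] := eqVneq; last by rewrite mulr0.
by case: Nm; exists v; rewrite // -Ek lem_addl.
Qed.

Lemma monomial_mulr I M v m : generated_by_monomials I M ->
  v \in M -> (v <= m)%MM -> 'X_[m] \in I.
Proof.
move=> IM vM vm; rewrite IM -(submK vm) mpolyXD.
by apply/gen_idealMr/mem_gen_ideal; exists v.
Qed.

(** The divisibility-minimal elements of [M] still generate, by descent on the degree. None can be
    omitted: a generator in [M'] dividing a minimal [m] equals [m]. *)
Lemma minimal_monomial_generators_exist I :
  monomial_ideal I -> exists M, minimal_monomial_generators I M.
Proof.
case=> M IM.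
pose M0 : {pred 'X_{1..n}} :=
  fun m => `[< m \in M /\ forall v, v \in M -> (v <= m)%MM -> v = m >].
have M0P m : m \in M -> exists2 v, v \in M0 & (v <= m)%MM.
  have [d] := ubnP (mdeg m); elim: d m => // d IHd m md mM.
  have [mM0|mM0] := boolP (m \in M0); first by exists m; rewrite ?lepm_refl.
  have [v [vM vm vNm]] : exists v, [/\ v \in M, (v <= m)%MM & v <> m].
    apply: contrapT => Nv; case/negP: mM0; apply/asboolP; split=> // v vM vm.
    by apply: contrapT => vNm; case: Nv; exists v.
  have [|w wM0 wv] := IHd v _ vM; last by exists w => //; apply: lepm_trans vm.
  apply: leq_trans (_ : mdeg m <= d)%N; last by [].
  rewrite -(submK vm) mdegD -[X in (X < _)%N]add0n ltn_add2r lt0n mdeg_eq0.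
  by apply/eqP => E0; apply: vNm; rewrite -(submK vm) E0 add0m.
exists M0; split=> [u|M' sM' IM' m /asboolP[mM minm]].
  rewrite IM; apply/idP/idP; apply: gen_ideal_sub => _ [m mM ->].
    have [v vM0 vm] := M0P m mM; rewrite -(submK vm) mpolyXD.
    by apply/gen_idealMr/mem_gen_ideal; exists v.
  by apply: mem_gen_ideal; exists m => //; case/asboolP: mM.
have [v vM' vm] := mem_monomial_ideal IM' (monomial_mulr IM mM (lepm_refl m)).
by rewrite -(minm v) //; have /asboolP[] := sM' v vM'.
Qed.

(** Existence is what gives the [epsilon] in [min_gens] its specification. *)
Lemma min_gensP I : monomial_ideal I -> generated_by_monomials I (min_gens I).
Proof.
move=> /minimal_monomial_generators_exist exM.
exact: (ClassicalEpsilon.epsilon_spec _ _ exM).1.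
Qed.

Lemma var_expP I i k : 'X_i ^+ k \in I -> 'X_i ^+ var_exp I i \in I.
Proof.
move=> Ik; have exk : exists k, ('X_i ^+ k \in I) by exists k.
have exb : exists b, 'X_i ^+ b \in I /\ forall k, 'X_i ^+ k \in I -> (b <= k)%N.
  by case: (ex_minnP exk) => b Ib minb; exists b.
exact: (ClassicalEpsilon.epsilon_spec (inhabits 0%N) _ exb).1.
Qed.

End MonomialIdeals.

(** * Krull dimension zero and powers of the variables *)

Lemma quotient_kernel_prime (R : comNzRingType) (I : idealr R)
    (D : idomainType) (phi : {rmorphism R -> D}) :
  (forall u, u \in I -> phi u = 0) ->
  exists P : prime_idealr {ideal_quot I},
    forall u, (\pi_({ideal_quot I})%qT u \in P) = (phi u == 0).
Proof.
move=> phiI; pose Q := {ideal_quot I}.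
(* The kernel of the map induced by [phi] on the quotient; [PE] shows that the choice of
   representative is harmless. *)
pose P : {pred Q} := fun q => phi (repr q) == 0.
have PE u : (\pi_Q%qT u \in P) = (phi u == 0).
  rewrite unfold_in.
  have : (repr (\pi_Q%qT u) - u \in I) by rewrite Quotient.idealrBE reprK.
  by move=> /phiI/eqP; rewrite rmorphB subr_eq0 /P => /eqP->.
have Pideal : idealr_closed P.
  split.
  - by rewrite -(rmorph0 \pi_Q%qT) PE rmorph0.
  - by rewrite -(rmorph1 \pi_Q%qT) PE rmorph1 oner_eq0.
  move=> a u v; rewrite -[a]reprK -[u]reprK -[v]reprK.
  rewrite -rmorphM -rmorphD !PE rmorphD rmorphM => /eqP-> /eqP->.
  by rewrite mulr0 addr0.
have Pprime : prime_idealr_closed P.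
  move=> u v; rewrite -[u]reprK -[v]reprK -rmorphM !PE rmorphM.
  by rewrite mulf_eq0.
pose Pi := isIdealr.Build Q P Pideal.
pose Pp := isPrimeIdealrClosed.Build Q P Pprime.
pose PP : prime_idealr Q := HB.pack P Pi Pp.
by exists PP => u; rewrite -PE.
Qed.

(* Otherwise the images in S/I of the ideals (x_j | j != i) and (x_1, ..., x_n)
   form a chain of two primes: the first contains I because no monomial of I
   is a power of x_i. *)
Lemma krull_dim0_var_exp (K : fieldType) (n : nat) (I : idealr {mpoly K[n]})
    (i : 'I_n) :
  monomial_ideal I -> krull_dim {ideal_quot I} 0 -> exists k, 'X_i ^+ k \in I.
Proof.
case=> M IM [_ nochain]; apply: contrapT => Nk; apply: nochain.
have memM v : v \in M -> exists2 j, j != i & (0 < v j)%N.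
  move=> vM; apply: contrapT => Nj; apply: Nk; exists (v i).
  rewrite mpolyXn; apply: (monomial_mulr IM vM); apply/mnm_lepP => j.
  rewrite mulmnE mnm1E; have [<-|ij] := eqVneq i j; first by rewrite mul1n.
  rewrite mul0n leqNgt; apply/negP => vj; apply: Nj.
  by exists j; rewrite 1?eq_sym.
pose h0 (j : 'I_n) : {poly K} := if j == i then 'X else 0.
pose phi0 : {rmorphism {mpoly K[n]} -> {poly K}} := mmap polyC h0.
pose phi1 : {rmorphism {mpoly K[n]} -> K} := meval (fun _ => 0 : K).
(* Evaluation at the origin factors through [phi0]; this gives both the inclusion of the kernels and
   the vanishing of [phi1] on [I]. *)
have phi10 u : phi1 u = (phi0 u).[0].
  rewrite /= /meval /mmap horner_sum; apply: eq_bigr => m _.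
  rewrite hornerM hornerC /mmap1 horner_prod; congr (_ * _).
  by apply: eq_bigr => j _; rewrite horner_exp /h0; case: eqP; rewrite hornerE.
have I0 u : u \in I -> phi0 u = 0.
  rewrite IM; apply: gen_ideal_morph_eq0 => _ [v /memM[j ji vj] ->] /=.
  rewrite mmapX /mmap1 (bigD1 j) //= /h0 (negPf ji) expr0n -leqn0 leqNgt vj.
  by rewrite mul0r.
have I1 u : u \in I -> phi1 u = 0 by move=> /I0 u0; rewrite phi10 u0 horner0.
have [P0 P0E] := quotient_kernel_prime I0.
have [P1 P1E] := quotient_kernel_prime I1.
exists (fun k : 'I_2 => if k == 0 then P0 else P1) => k l kl.
have -> : k = 0 by apply/val_inj => /=; case: k l kl => [[|[|]]] // ? [[|[|]]].
have -> : l = 1 by apply/val_inj => /=; case: l kl => [[|[|]]] //; case: k.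
split=> /= [q|].
  by rewrite -[q]reprK P0E P1E phi10 => /eqP->; rewrite horner0.
(* The inclusion is strict: [phi1] kills ['X_i], while [phi0] sends it to ['X]. *)
move/(_ (\pi_({ideal_quot I})%qT 'X_i)); rewrite P0E P1E /= mevalXU eqxx.
by rewrite mmapX mmap1U /h0 eqxx polyX_eq0 => /(_ isT).
Qed.

(** * Faces of the polarization complex *)

Section Polarization.
Variables (K : fieldType) (n : nat) (I : {pred {mpoly K[n]}}).

(** A single product over pairs can be compared with a product over a set of variables. *)
Lemma polarizeE (v : 'X_{1..n}) :
  polarize I v = \prod_(x : polvar I | (tagged x < v (tag x))%N) polX x.
Proof.
rewrite /polarize.
rewrite (sig_big_dep (fun _ => true) (fun i (j : 'I_(var_exp I i)) => j < v i)%N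
  (fun i j => polX (Tagged (fun i => 'I_(var_exp I i)) j))) /=.
by apply: eq_bigr => -[].
Qed.

Lemma mem_polarizationP (F : {set polvar I}) :
  reflect (exists2 v, v \in min_gens I &
             forall x : polvar I, (tagged x < v (tag x))%N -> x \in F)
    (\prod_(x in F) polX x \in polarization I).
Proof.
apply: (iffP idP) => [FI|[v vI vF]].
  (* Evaluate at the indicator of [F]: the product over [F] becomes 1, while a polarized generator
     with a variable outside [F] becomes 0. *)
  pose h (k : 'I_#|polvar I|) : K := (enum_val k \in F)%:R.
  have hX x : meval h (polX x) = (x \in F)%:R.
    by rewrite mevalXU /h enum_rankK.
  apply: contrapT => Nv.
  have /(_ _ _)/(_ _ FI) := @gen_ideal_morph_eq0 _ _ _ (meval h).
  rewrite rmorph_prod big1 => [F0|x xF]; last by rewrite /= hX xF.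
  suff /F0/eqP : forall g, (exists2 v, v \in min_gens I & g = polarize I v) ->
      meval h g = 0 by rewrite oner_eq0.
  move=> _ [v vI ->]; have [x xv xF] : exists2 x : polvar I,
      (tagged x < v (tag x))%N & x \notin F.
    apply: contrapT => Nx; apply: Nv; exists v => // x xv.
    by apply: contrapT => /negP xF; apply: Nx; exists x.
  by rewrite polarizeE rmorph_prod (bigD1 x) //= hX (negPf xF) mul0r.
rewrite (bigID (fun x : polvar I => tagged x < v (tag x))%N) /= mulrC.
apply: gen_idealMr; apply: mem_gen_ideal; exists v; rewrite // polarizeE.
by apply: eq_bigl => x; rewrite andb_idl //; apply: vF.
Qed.

End Polarization.

Theorem theorem3p1 (K : fieldType) (n : nat) (I : idealr {mpoly K[n]})
    (I_monomial : monomial_ideal I)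
    (dim_quotient : krull_dim {ideal_quot I} 0) :
  vertex_decomposable (Delta I).
Proof.
have IM := min_gensP I_monomial.
have Ib i : 'X_i ^+ var_exp I i \in I.
  by have [k /var_expP] := krull_dim0_var_exp i I_monomial dim_quotient.
(* A zero exponent would put 1 in the proper ideal [I]. *)
have b_gt0 i : (0 < var_exp I i)%N.
  by rewrite lt0n; apply/eqP => b0; have := Ib i; rewrite b0 expr0 idealr1.
pose x_ i (j : 'I_(var_exp I i)) : polvar I := Tagged _ j.
pose column i := [seq x_ i j | j <- enum 'I_(var_exp I i)].
have columnsT (x : polvar I) : x \in flatten [seq column i | i <- enum 'I_n].
  case: x => i j; apply/flatten_mapP; exists i; rewrite ?mem_enum //.
  by apply/mapP; exists j; rewrite ?mem_enum.
apply: (@shedding_columns_vertex_decomposable _ _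
  [seq column i | i <- enum 'I_n]).
  (* As [I] is proper, no generator is 1, so each polarized generator involves the first variable of
     some column. *)
  rewrite inE; apply/mem_polarizationP => -[v vI v0].
  have [i vi] : exists i, (0 < v i)%N.
    apply: contrapT => Ni; have := monomial_mulr IM vI (lepm_refl v).
    have -> : v = 0%MM.
      apply/mnmP => i; rewrite mnm0E; apply/eqP; rewrite -leqn0 leqNgt.
      by apply/negP => vi; apply: Ni; exists i.
    by rewrite mpolyX0 idealr1.
  by have := v0 (x_ i (Ordinal (b_gt0 i))) vi; rewrite inE.
split=> [|s F /mapP[i _ ->]|s x y F /mapP[i _ ->]|y F]; last first.
- by rewrite columnsT.
- move=> xy; rewrite !inE => /mem_polarizationP Fface xF.
  have tag_column z : z \in [:: x; y] -> tag z = i.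
    by move=> /(mem_subseq xy)/mapP[j _ ->].
  have tagE : tag x = tag y by rewrite !tag_column ?inE ?eqxx ?orbT.
  have ltxy : (tagged x < tagged y)%N.
    pose r := [rel x y : polvar I | tagged x < tagged y]%N.
    have /(subseq_sorted _ xy) : sorted r (column i).
      rewrite sorted_map; have := iota_ltn_sorted 0 (var_exp I i).
      by rewrite -val_enum_ord sorted_map.
    by rewrite /= andbT; apply=> ? ? ?; apply: ltn_trans.
  (* If [v] required [y], it would also require the earlier [x], which is not in [y |: F]. Hence all
     that [v] requires is already in [F]. *)
  apply/mem_polarizationP => -[v vI vF]; apply: Fface; exists v => // z zv.
  have := vF z zv; rewrite !inE => /predU1P[Ez|//]; rewrite {z}Ez in zv *.
  have /vF : (tagged x < v (tag x))%N.
    by apply: (ltn_trans ltxy); move: zv; rewrite -(congr1 v tagE).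
  rewrite !inE (negPf xF) orbF => /eqP xy_eq.
  by move: ltxy; rewrite xy_eq ltnn.
- rewrite inE => /mem_polarizationP Fface; apply/allP => cF; apply: Fface.
  (* A generator dividing the power of ['X_i] involves no other variable, so its polarization uses
     only column [i]. *)
  have := Ib i; rewrite mpolyXn => /(mem_monomial_ideal IM)[v vI /mnm_lepP vi].
  exists v => // -[k j] /= jv; have := vi k; rewrite mulmnE mnm1E.
  have [ik|_] := eqVneq i k; last by rewrite mul0n leqNgt (leq_ltn_trans _ jv).
  by case: k / ik j jv => j jv _; apply: cF; rewrite map_f ?mem_enum.
apply: allpairs_uniq_dep => [|i _|]; rewrite ?enum_uniq //.
by move=> [i j] [k l].
Qed.
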